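(* Let $d\ge1$ and let $\mathbf{C}_1,\dots,\mathbf{C}_d$ be real square matrices, $\mathbf{C}_i\in\mathbb{R}^{n_i\times n_i}$, each having a Cholesky decomposition $\mathbf{C}_i=\mathbf{L}_i\mathbf{L}_i^T$ with $\mathbf{L}_i$ lower triangular, $i=1,\dots,d$. Then $$\mathbf{C}_1\otimes\cdots\otimes\mathbf{C}_d=(\mathbf{L}_1\mathbf{L}_1^T)\otimes\cdots\otimes(\mathbf{L}_d\mathbf{L}_d^T)=(\mathbf{L}_1\otimes\cdots\otimes\mathbf{L}_d)\cdot(\mathbf{L}_1^T\otimes\cdots\otimes\mathbf{L}_d^T)=\mathbf{L}\,\mathbf{L}^T,$$ where $\mathbf{L}:=\mathbf{L}_1\otimes\cdots\otimes\mathbf{L}_d$ and $\mathbf{L}^T=\mathbf{L}_1^T\otimes\cdots\otimes\mathbf{L}_d^T$ are lower triangular and upper triangular matrices, respectively.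
   Context: $\otimes$ denotes the Kronecker product of matrices. *)

(* Defs.v *)
From mathcomp Require Import all_boot all_order all_algebra.
From mathcomp Require Import reals.
From mathcomp Require Export mxtens.

Set Implicit Arguments.
Unset Strict Implicit.
Unset Printing Implicit Defensive.

Import GRing.Theory.
Local Open Scope ring_scope.

(* The product n_0 * ... * n_d, as an iterated [muln] rather than a \prod, so
   that it is definitionally the dimension of an iterated [tensmx] and [bigkron]
   needs no cast. *)
Fixpoint krondim (d : nat) : ('I_d.+1 -> nat) -> nat :=
  match d return ('I_d.+1 -> nat) -> nat with
  | 0 => fun n => n ord0
  | d'.+1 => fun n =>
      (krondim (fun i : 'I_d'.+1 => n (widen_ord (leqnSn d'.+1) i))
       * n ord_max)%N
  end.

(* A_0 *t A_1 *t ... *t A_d, left associated, where *t is the Kronecker product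
   of mxtens; on a single factor it is that factor itself. *)
Fixpoint bigkron (R : pzRingType) (d : nat) :
    forall m n : 'I_d.+1 -> nat, (forall i, 'M[R]_(m i, n i)) ->
    'M[R]_(krondim m, krondim n) :=
  match d return forall m n : 'I_d.+1 -> nat,
    (forall i, 'M[R]_(m i, n i)) -> 'M[R]_(krondim m, krondim n) with
  | 0 => fun m n A => A ord0
  | d'.+1 => fun m n A =>
      bigkron (fun i : 'I_d'.+1 => A (widen_ord (leqnSn d'.+1) i))
      *t A ord_max
  end.

(* [is_trig_mx] means lower triangular; this is its upper counterpart. *)
Definition is_utrig_mx (R : pzRingType) (m n : nat) (A : 'M[R]_(m, n)) : bool :=
  [forall i : 'I_m, forall j : 'I_n, (j < i)%N ==> (A i j == 0)].

(* Main.v *)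
Require Import Defs.
From mathcomp Require Import all_boot all_order all_algebra.
From mathcomp Require Import reals.

Import GRing.Theory.
Local Open Scope ring_scope.

(** Kronecker products of two matrices satisfy the mixed-product rule
    [(A *m B) *t (C *m D) = (A *t C) *m (B *t D)], commute with transposition,
    and preserve lower triangularity; each property passes to the iterated
    product [bigkron] by induction on the number of factors, and together they
    give the theorem.

    Triangularity holds because the row and column indices of [A *t B] are
    pairs ordered lexicographically: to the right of the diagonal, either the
    pair of [A]-indices is already strictly to the right of the diagonal of
    [A], or it is on that diagonal and the pair of [B]-indices is strictly to
    the right of the diagonal of [B]. One of the two factors of the entry is
    then zero ([tensmx_trig]). *)

Lemma eq_bigkron (R : pzRingType) (d : nat) (m n : 'I_d.+1 -> nat)
    (A B : forall i, 'M[R]_(m i, n i)) :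
  (forall i, A i = B i) -> bigkron A = bigkron B.
Proof.
elim: d m n A B => [|d IHd] m n A B eqAB /=; first exact: eqAB.
by rewrite eqAB; congr (_ *t _); apply: IHd => i; apply: eqAB.
Qed.

(** Mixed-product rule. [R] has to be commutative: already for 1 x 1 matrices it
    reads [(a * b) * (c * d) = (a * c) * (b * d)]. *)
Lemma bigkron_mul (R : comPzRingType) (d : nat) (m n p : 'I_d.+1 -> nat)
    (A : forall i, 'M[R]_(m i, n i)) (B : forall i, 'M[R]_(n i, p i)) :
  bigkron (fun i => A i *m B i) = bigkron A *m bigkron B.
Proof.
elim: d m n p A B => [//|d IHd] m n p A B /=.
by rewrite tensmx_mul -IHd.
Qed.

Lemma trmx_bigkron (R : pzRingType) (d : nat) (m n : 'I_d.+1 -> nat)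
    (A : forall i, 'M[R]_(m i, n i)) :
  (bigkron A)^T = bigkron (fun i => (A i)^T).
Proof.
elim: d m n A => [//|d IHd] m n A /=.
by rewrite trmx_tens IHd.
Qed.

(** The right factor must be square, so that row and column indices of the
    product are split into pairs by the same Euclidean division. *)
Lemma tensmx_trig (R : pzRingType) (m n p : nat)
    (A : 'M[R]_(m, n)) (B : 'M[R]_p) :
  is_trig_mx A -> is_trig_mx B -> is_trig_mx (A *t B).
Proof.
move=> /is_trig_mxP trigA /is_trig_mxP trigB; apply/is_trig_mxP => i j lt_ij.
rewrite mxE; case: (ltngtP (i %/ p) (j %/ p)) => [lt_div|gt_div|eq_div].
- by rewrite trigA ?mul0r.
- (* The quotients of [i < j] cannot be in decreasing order. *)
  by move: gt_div; rewrite ltnNge leq_div2r // ltnW.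
- rewrite trigB ?mulr0 //=.
  by move: lt_ij; rewrite {1}(divn_eq i p) {1}(divn_eq j p) eq_div ltn_add2l.
Qed.

Lemma bigkron_trig (R : pzRingType) (d : nat) (n : 'I_d.+1 -> nat)
    (A : forall i, 'M[R]_(n i)) :
  (forall i, is_trig_mx (A i)) -> is_trig_mx (bigkron A).
Proof.
elim: d n A => [|d IHd] n A trigA /=; first exact: trigA.
by apply: tensmx_trig (trigA _); apply: IHd => i; apply: trigA.
Qed.

Lemma is_utrig_trmx (R : pzRingType) (m n : nat) (A : 'M[R]_(m, n)) :
  is_trig_mx A -> is_utrig_mx A^T.
Proof.
move=> /is_trig_mxP trigA.
by apply/'forall_'forall_implyP => i j lt_ji; rewrite mxE trigA.
Qed.

Theorem lemma4p8 (R : realType) (d : nat) (n : 'I_d.+1 -> nat)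
    (C L_ : forall i : 'I_d.+1, 'M[R]_(n i))
    (L_lower : forall i, is_trig_mx (L_ i))
    (cholesky : forall i, C i = L_ i *m (L_ i)^T) :
  let L := bigkron L_ in
  [/\ bigkron C = bigkron (fun i => L_ i *m (L_ i)^T),
      bigkron (fun i => L_ i *m (L_ i)^T)
        = bigkron L_ *m bigkron (fun i => (L_ i)^T),
      bigkron L_ *m bigkron (fun i => (L_ i)^T) = L *m L^T,
      L^T = bigkron (fun i => (L_ i)^T)
    & is_trig_mx L /\ is_utrig_mx L^T].
Proof.
have trigL := bigkron_trig _ _ _ _ L_lower.
split.
- exact: eq_bigkron.
- exact: bigkron_mul.
- by rewrite trmx_bigkron.
- exact: trmx_bigkron.
- by split; last exact: is_utrig_trmx.
Qed.
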